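(* The field $\mathcal{O}_{RP}\subset\mathbb{C}$ of regular origami numbers contains $\zeta_n=e^{2\pi i/n}$ for every $n\in\mathbb{N}$, $n\ge1$.
   Context: Constructions. Identify $\mathbb{C}$ with the Euclidean plane. A construction starts with the points $0,1$ (given) and proceeds by finitely many steps; each step adds a new constructed line or point obtained from previously constructed (''given'') ones by one of the axioms below. Folding along a line $f$ means applying the reflection across $f$; ''folding $f$ places a point $p$ onto a line $\ell$'' means that the reflection of $p$ across $f$ lies on $\ell$. Huzita-Justin axioms (HJAs): (O1) we can fold the line connecting two given distinct points; (O2) we can fold the perpendicular bisector of two given distinct points; (O3) we can fold the bisector of the angle defined by two given lines (either bisector, for intersecting lines); (O4) we can fold, through a given point, the perpendicular to a given line; (O5) we can fold a line passing through a given point that places another given point onto a given line; (O6) we can fold a line that places simultaneously two given points onto two given lines, respectively; (O7) we can fold a line perpendicular to a given line that places a given point onto another given line; (LI) the intersection point of two given non-parallel lines is constructible. In O5, O6, O7 the axiom is applied only to inputs for which there are finitely many lines with the required property, and any of these lines may be constructed. Regular Polygon Axioms (RPAs): for each $n\ge 3$, ($\mathrm{RPA}_n$) given the vertices $A_1,\dots,A_{n+1}$ (in counterclockwise order) of a regular $(n+1)$-gon, we can fold the line containing any side of the regular $n$-gon with vertices $B_1,\dots,B_n$ (in counterclockwise order) determined by $B_1=A_1$ and $B_2=A_2$. A number $\alpha\in\mathbb{C}$ is a regular origami number if there is a finite sequence of applications of the HJAs and the RPAs that starts with $\{0,1\}$ and ends in the point $\alpha$. $\mathcal{O}_{RP}$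 denotes the set of all regular origami numbers. *)

(* Defs.v *)
From Stdlib Require List.
From HB Require Import structures.
From mathcomp Require Import all_boot all_order all_algebra.
From mathcomp Require Import all_classical all_reals all_analysis.
From mathcomp Require Import complex.

Set Implicit Arguments.
Unset Strict Implicit.
Unset Printing Implicit Defensive.

Import Order.TTheory GRing.Theory Num.Theory.

Local Open Scope classical_set_scope.
Local Open Scope ring_scope.
Local Open Scope complex_scope.

(* [expi t] is e^{i t}. *)
Definition expi (R : realType) (t : R) : R[i] := cos t +i* sin t.

Definition zeta (R : realType) (n : nat) : R[i] := expi (2 * pi / n%:R).

(** Lines of the Euclidean plane [R[i]] *)

Definition line_through (R : realType) (a b : R[i]) : set R[i] :=
  [set a + t%:C * (b - a) | t in [set: R]].

Definition is_line (R : realType) (l : set R[i]) : Prop :=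
  exists a b : R[i], a != b /\ l = line_through a b.

Definition parallel (R : realType) (l m : set R[i]) : Prop :=
  l = m \/ l `&` m = set0.

(* Re (u * conj v) is the Euclidean inner product of u and v. *)
Definition perpendicular (R : realType) (l m : set R[i]) : Prop :=
  forall a b c d : R[i], l a -> l b -> m c -> m d ->
    complex.Re ((b - a) * (d - c)^*) = 0.

Definition perp_bisector (R : realType) (p q : R[i]) : set R[i] :=
  [set z | `|z - p| = `|z - q|].

(** Folding *)

(* The reflection across the line through two distinct points a and b: the
   fraction has modulus 1, and its argument is twice that of b - a. *)
Definition reflect_across (R : realType) (a b z : R[i]) : R[i] :=
  a + (b - a) / (b - a)^* * (z - a)^*.

(* [reflect_across a b] depends only on the line through a and b, so the choice
   of a and b is irrelevant in the next two definitions. *)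
Definition places_point (R : realType) (f : set R[i]) (p : R[i])
    (l : set R[i]) : Prop :=
  exists a b : R[i],
    [/\ a != b, f = line_through a b & l (reflect_across a b p)].

Definition places_line (R : realType) (f l m : set R[i]) : Prop :=
  exists a b : R[i],
    [/\ a != b, f = line_through a b & reflect_across a b @` l = m].

(* The bisectors of two distinct lines are the axes of the reflections carrying
   one onto the other: both angle bisectors if the lines intersect, the
   mid-parallel if they are parallel.  For l = m there is no angle to bisect,
   while every perpendicular to l would carry l onto m. *)
Definition bisector (R : realType) (l m f : set R[i]) : Prop :=
  l <> m /\ places_line f l m.

Definition folds_O5 (R : realType) (p q : R[i]) (l : set R[i]) :
    set (set R[i]) :=
  [set f | [/\ is_line f, f p & places_point f q l]].

Definition folds_O6 (R : realType) (p q : R[i]) (l m : set R[i]) :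
    set (set R[i]) :=
  [set f | [/\ is_line f, places_point f p l & places_point f q m]].

Definition folds_O7 (R : realType) (p : R[i]) (l m : set R[i]) :
    set (set R[i]) :=
  [set f | [/\ is_line f, perpendicular f l & places_point f p m]].

(** Regular polygons *)

(* [A 0, ..., A (N - 1)] are the vertices, in counterclockwise order, of a
   regular N-gon; c is its center. *)
Definition regular_polygon (R : realType) (N : nat) (A : nat -> R[i]) : Prop :=
  exists c r : R[i],
    r != 0 /\ forall k, (k < N)%N -> A k = c + r * zeta R N ^+ k.

(** Constructions *)

Inductive object (R : realType) : Type :=
| Point of R[i]
| Line of set R[i].

Definition given (R : realType) (s : seq (object R)) (o : object R) : Prop :=
  List.In o s.

Inductive HJA (R : realType) (s : seq (object R)) : object R -> Prop :=
| HJA_O1 (p q : R[i]) :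
    given s (Point p) -> given s (Point q) -> p != q ->
    HJA s (Line (line_through p q))
| HJA_O2 (p q : R[i]) :
    given s (Point p) -> given s (Point q) -> p != q ->
    HJA s (Line (perp_bisector p q))
| HJA_O3 (l m f : set R[i]) :
    given s (Line l) -> given s (Line m) -> bisector l m f ->
    HJA s (Line f)
| HJA_O4 (p : R[i]) (l f : set R[i]) :
    given s (Point p) -> given s (Line l) ->
    is_line f -> f p -> perpendicular f l ->
    HJA s (Line f)
| HJA_O5 (p q : R[i]) (l f : set R[i]) :
    given s (Point p) -> given s (Point q) -> p != q -> given s (Line l) ->
    finite_set (folds_O5 p q l) -> folds_O5 p q l f ->
    HJA s (Line f)
| HJA_O6 (p q : R[i]) (l m f : set R[i]) :
    given s (Point p) -> given s (Point q) ->
    given s (Line l) -> given s (Line m) ->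
    finite_set (folds_O6 p q l m) -> folds_O6 p q l m f ->
    HJA s (Line f)
| HJA_O7 (p : R[i]) (l m f : set R[i]) :
    given s (Point p) -> given s (Line l) -> given s (Line m) ->
    finite_set (folds_O7 p l m) -> folds_O7 p l m f ->
    HJA s (Line f)
| HJA_LI (l m : set R[i]) (z : R[i]) :
    given s (Line l) -> given s (Line m) -> ~ parallel l m ->
    l z -> m z ->
    HJA s (Point z).

(* The vertices A_1, ..., A_{n+1} and B_1, ..., B_n are indexed from 0. *)
Inductive RPA (R : realType) (n : nat) (s : seq (object R)) :
    object R -> Prop :=
| RPA_side (A B : nat -> R[i]) (k : nat) :
    (3 <= n)%N ->
    regular_polygon n.+1 A ->
    (forall j, (j < n.+1)%N -> given s (Point (A j))) ->
    regular_polygon n B -> B 0%N = A 0%N -> B 1%N = A 1%N ->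
    (k < n)%N ->
    RPA n s (Line (line_through (B k) (B (k.+1 %% n)%N))).

(* The objects given at some stage, most recent first. *)
Inductive construction (R : realType) : seq (object R) -> Prop :=
| construction_start : construction [:: Point 1; Point 0]
| construction_HJA s o :
    construction s -> HJA s o -> construction (o :: s)
| construction_RPA n s o :
    construction s -> RPA n s o -> construction (o :: s).

(* A construction may repeat objects already given, so its last object can be
   any of the points it constructs, in particular 0. *)
Definition regular_origami (R : realType) : set R[i] :=
  [set z | exists s, construction (Point z :: s)].

Arguments regular_origami R : clear implicits.

(* Main.v *)
(* The constructible points are determined by their real coordinates, and
   perpendiculars together with the bisector y = x of the axes make these
   coordinates a subfield of the reals; hence the constructible points form a
   field.  Bisecting the angle with the real axis repeatedly gives the lines
   through 0 of direction e^{i pi / 2^k}, hence every zeta (2^k).  If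
   zeta (n + 1) is constructible, with n >= 3, then so is the (n + 1)-gon of its
   powers, hence so are the sides of the n-gon erected on its first side, and
   zeta n is a ratio of two of those sides.  Descending from 2^m reaches every
   m >= 3. *)

Require Import Defs.
From HB Require Import structures.
From mathcomp Require Import all_boot all_order all_algebra.
From mathcomp Require Import all_classical all_reals all_analysis.
From mathcomp Require Import complex ring lra.

Set Implicit Arguments.
Unset Strict Implicit.

Import Order.TTheory GRing.Theory Num.Theory.
Local Open Scope classical_set_scope.
Local Open Scope ring_scope.
Local Open Scope complex_scope.

(** * Constructible objects and the merging of constructions *)

(** Unlike [regular_origami], this lets the object occur anywhere in the construction and covers
    lines, so it survives extending and merging constructions. [constructibleP] reconciles the two
    notions for points. *)
Definition constructible (R : realType) (o : object R) : Prop :=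
  exists2 s, construction s & given s o.

Lemma HJA_mono (R : realType) (s s' : seq (object R)) o :
  List.incl s s' -> HJA s o -> HJA s' o.
Proof.
move=> ss'; case.
- by move=> p q /ss' ? /ss' ? ?; apply: HJA_O1.
- by move=> p q /ss' ? /ss' ? ?; apply: HJA_O2.
- by move=> l m f /ss' ? /ss' ?; apply: HJA_O3.
- by move=> p l f /ss' ? /ss' ?; apply: HJA_O4.
- by move=> p q l f /ss' ? /ss' ? ? /ss' ?; apply: HJA_O5.
- by move=> p q l m f /ss' ? /ss' ? /ss' ? /ss' ?; apply: HJA_O6.
- by move=> p l m f /ss' ? /ss' ? /ss' ?; apply: HJA_O7.
- by move=> l m z /ss' ? /ss' ?; apply: HJA_LI.
Qed.

Lemma RPA_mono (R : realType) n (s s' : seq (object R)) o :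
  List.incl s s' -> RPA n s o -> RPA n s' o.
Proof.
move=> ss' [A B k n3 regA sA]; apply: RPA_side => // j jn.
exact/ss'/sA.
Qed.

Lemma construction_start_incl (R : realType) (s : seq (object R)) :
  construction s -> List.incl [:: Point 1; Point 0] s.
Proof.
elim=> [|s' o _ IH _|n s' o _ IH _]; first by move.
- by move=> x sx; right; auto.
- by move=> x sx; right; auto.
Qed.

(** The steps of [s1] are replayed on top of [s2]. Each stays legal because the axioms mention the
    current list only through [given]; the finiteness conditions of O5 to O7 range over all lines of
    the plane. *)
Lemma construction_merge (R : realType) (s1 s2 : seq (object R)) :
  construction s1 -> construction s2 ->
  exists s, [/\ construction s, List.incl s1 s & List.incl s2 s].
Proof.
move=> cs1 cs2; elim: cs1 => [|s o _ [s' [cs' ss' s2s']] so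
                             |n s o _ [s' [cs' ss' s2s']] so].
- exists s2; split=> //; exact: construction_start_incl.
- exists (o :: s'); split; last by move=> x sx; right; auto.
    exact: construction_HJA cs' (HJA_mono ss' so).
  by apply: List.incl_cons; [left | apply: List.incl_tl].
- exists (o :: s'); split; last by move=> x sx; right; auto.
    exact: construction_RPA cs' (RPA_mono ss' so).
  by apply: List.incl_cons; [left | apply: List.incl_tl].
Qed.

(** A regular polygon axiom wants all its vertices in one and the same construction. *)
Lemma constructible_family (R : realType) n (F : nat -> object R) :
  (forall j, (j < n)%N -> constructible (F j)) ->
  exists2 s, construction s & forall j, (j < n)%N -> given s (F j).
Proof.
elim: n => [|n IH] cF; first by exists [:: Point 1; Point 0] => //; exact: construction_start.
have [j jn|s1 cs1 s1F] := IH; first exact/cF/ltnW.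
have [s2 cs2 s2F] := cF n (ltnSn n).
have [s [cs s1s s2s]] := construction_merge cs1 cs2.
exists s => // j; rewrite ltnS leq_eqVlt => /predU1P[->|jn]; first exact: s2s.
exact/s1s/s1F.
Qed.

Lemma constructible_pair (R : realType) (o1 o2 : object R) :
  constructible o1 -> constructible o2 ->
  exists s, [/\ construction s, given s o1 & given s o2].
Proof.
move=> [s1 cs1 s1o1] [s2 cs2 s2o2].
have [s [cs s1s s2s]] := construction_merge cs1 cs2.
by exists s; split; [|exact: s1s|exact: s2s].
Qed.

Lemma HJA_constructible (R : realType) (s : seq (object R)) o :
  construction s -> HJA s o -> constructible o.
Proof. by move=> cs so; exists (o :: s); [exact: construction_HJA | left]. Qed.

Lemma constructible_RPA (R : realType) (n k : nat) (A B : nat -> R[i]) :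
  (3 <= n)%N -> regular_polygon n.+1 A ->
  (forall j, (j < n.+1)%N -> constructible (Point (A j))) ->
  regular_polygon n B -> B 0%N = A 0%N -> B 1%N = A 1%N -> (k < n)%N ->
  constructible (Line (line_through (B k) (B (k.+1 %% n)%N))).
Proof.
move=> n3 regA cA regB B0 B1 kn.
have [s cs sA] := constructible_family cA.
exists (Line (line_through (B k) (B (k.+1 %% n)%N)) :: s); last by left.
by apply: (@construction_RPA _ n) => //; apply: (@RPA_side _ _ _ A).
Qed.

(** * Lines, perpendiculars and intersections in coordinates *)

(** This is the imaginary part of [u^* * v], the signed area spanned by [u] and [v]. It turns
    incidence and parallelism into polynomial equations over [R]. *)
Definition cross (R : realType) (u v : R[i]) : R :=
  complex.Re u * complex.Im v - complex.Im u * complex.Re v.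

Definition dot (R : realType) (u v : R[i]) : R :=
  complex.Re u * complex.Re v + complex.Im u * complex.Im v.

Lemma line_throughP (R : realType) (a b z : R[i]) : a != b ->
  line_through a b z <-> cross (b - a) (z - a) = 0.
Proof.
case: a b z => [a1 a2] [b1 b2] [z1 z2]; rewrite eq_complex /= negb_and => ab.
rewrite /line_through /cross /=; split=> [[t _]|].
  by move/eqP; rewrite eq_complex /= => /andP[/eqP <- /eqP <-]; ring.
(* Some coordinate of [b - a] is nonzero; the parameter is the quotient taken in that coordinate,
   and [h] settles the other one. *)
move=> h; have [e|e] := eqVneq (b1 - a1) 0.
  have e2 : b2 - a2 != 0.
    by move: ab; rewrite (eq_sym a1) (eq_sym a2) -(subr_eq0 b1) e eqxx subr_eq0.
  exists ((z2 - a2) / (b2 - a2)) => //; apply/eqP; rewrite eq_complex /=.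
  have e3 : z1 - a1 = 0.
    by apply/(mulfI e2); move: h; rewrite e mul0r mulr0; lra.
  rewrite e; apply/andP; split; apply/eqP; first by lra.
  by field.
exists ((z1 - a1) / (b1 - a1)) => //; apply/eqP; rewrite eq_complex /=.
apply/andP; split; apply/eqP; first by field.
apply: (mulfI e); transitivity (a2 * (b1 - a1) + (z1 - a1) * (b2 - a2)).
  by field.
by lra.
Qed.

Lemma line_through_left (R : realType) (a b : R[i]) : line_through a b a.
Proof. by exists 0 => //; rewrite mul0r addr0. Qed.

Lemma line_through_right (R : realType) (a b : R[i]) : line_through a b b.
Proof. by exists 1 => //; rewrite mul1r addrC subrK. Qed.

Lemma constructible_line (R : realType) (p q : R[i]) :
  constructible (Point p) -> constructible (Point q) -> p != q ->
  constructible (Line (line_through p q)).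
Proof.
move=> cp cq pq; have [s [cs sp sq]] := constructible_pair cp cq.
exact/(HJA_constructible cs)/HJA_O1.
Qed.

Lemma constructible_perp (R : realType) (p q a b : R[i]) :
  constructible (Point p) -> constructible (Line (line_through a b)) ->
  p != q -> dot (q - p) (b - a) = 0 ->
  constructible (Line (line_through p q)).
Proof.
move=> cp cl pq pqab; have [s [cs sp sl]] := constructible_pair cp cl.
apply/(HJA_constructible cs)/(HJA_O4 sp sl).
- by exists p, q.
- exact: line_through_left.
move=> _ _ _ _ [t1 _ <-] [t2 _ <-] [t3 _ <-] [t4 _ <-].
move: pqab; rewrite /dot.
case: p q a b {cp cl pq sp sl} => [p1 p2] [q1 q2] [a1 a2] [b1 b2] /= h.
transitivity ((t2 - t1) * (t4 - t3) *
  ((q1 - p1) * (b1 - a1) + (q2 - p2) * (b2 - a2))); first by ring.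
by rewrite h mulr0.
Qed.

(** The conclusion has [z] as the last object of a construction, the form in which [constructibleP]
    uses it to rebuild 0. *)
Lemma regular_origami_meet (R : realType) (a b c d z : R[i]) :
  constructible (Line (line_through a b)) ->
  constructible (Line (line_through c d)) ->
  cross (b - a) (d - c) != 0 ->
  cross (b - a) (z - a) = 0 -> cross (d - c) (z - c) = 0 ->
  regular_origami R z.
Proof.
move=> cl cm abcd abz cdz; have [s [cs sl sm]] := constructible_pair cl cm.
have ab : a != b.
  by apply: contraNneq abcd => ->; rewrite subrr /cross !mul0r subr0.
have cd : c != d.
  by apply: contraNneq abcd => ->; rewrite subrr /cross !mulr0 subr0.
have lz : line_through a b z by apply/line_throughP.
have mz : line_through c d z by apply/line_throughP.
exists s; apply: (construction_HJA cs); apply: (HJA_LI sl sm) => //.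
(* Disjointness is refuted by [z]. If the lines coincide, then [a] and [b] both lie on the second
   one, which makes the directions parallel. *)
case=> [lm|]; last by apply/eqP/set0P; exists z.
have /(line_throughP _ cd) ma : line_through c d a.
  by rewrite -lm; exact: line_through_left.
have /(line_throughP _ cd) mb : line_through c d b.
  by rewrite -lm; exact: line_through_right.
case/eqP: abcd; move: ma mb; rewrite /cross.
case: a b c d {cl cm abz cdz ab cd lz mz sl sm lm} => [? ?] [? ?] [? ?] [? ?] /=.
by lra.
Qed.

Lemma regular_origami_constructible (R : realType) (z : R[i]) :
  regular_origami R z -> constructible (Point z).
Proof. by move=> [s cs]; exists (Point z :: s) => //; left. Qed.

Lemma constructible_meet (R : realType) (a b c d z : R[i]) :
  constructible (Line (line_through a b)) ->
  constructible (Line (line_through c d)) ->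
  cross (b - a) (d - c) != 0 ->
  cross (b - a) (z - a) = 0 -> cross (d - c) (z - c) = 0 ->
  constructible (Point z).
Proof.
move=> cl cm h1 h2 h3.
exact/regular_origami_constructible/(regular_origami_meet cl cm).
Qed.

(** * The axes, angle bisection and the diagonals *)

Lemma constructible0 (R : realType) : constructible (Point (0 : R[i])).
Proof. by exists [:: Point 1; Point 0]; [exact: construction_start | right; left]. Qed.

Lemma constructible1 (R : realType) : constructible (Point (1 : R[i])).
Proof. by exists [:: Point 1; Point 0]; [exact: construction_start | left]. Qed.

Lemma constructible_real_axis (R : realType) :
  constructible (Line (line_through (0 : R[i]) 1)).
Proof.
apply: constructible_line (constructible0 R) (constructible1 R) _.
by rewrite eq_sym oner_eq0.
Qed.

Lemma constructible_imaginary_axis (R : realType) (y : R) : y != 0 ->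
  constructible (Line (line_through (0 : R[i]) (0 +i* y))).
Proof.
move=> y0; apply: (constructible_perp (constructible0 R)
  (constructible_real_axis R)).
  by rewrite eq_complex /= eqxx eq_sym.
by rewrite /dot /=; ring.
Qed.

Lemma constructibleP (R : realType) (z : R[i]) :
  constructible (Point z) <-> regular_origami R z.
Proof.
split; last exact: regular_origami_constructible.
case=> s; elim=> [|s' o cs' IH so|n s' o cs' IH so].
- case=> [[<-]|[[<-]|//]]; first by exists [:: Point 0]; exact: construction_start.
  (* The starting list ends in 1, so 0 has to be constructed afresh, as the intersection of the
     axes. *)
  apply: (regular_origami_meet (constructible_real_axis R)
    (constructible_imaginary_axis (oner_neq0 R))); rewrite /cross /=; last 2 first.
  + by ring.
  + by ring.
  by apply/eqP; lra.
- case=> [oz|/IH//]; subst o; exists s'; exact: construction_HJA.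
(* The polygon axioms add only lines. *)
- by case=> [oz|/IH//]; move: oz; case: so.
Qed.

(* The reflection across the line of [u] multiplies conjugates by
   [u / u^* = u ^+ 2 / `|u| ^+ 2], so it sends the real axis to the line of
   [u ^+ 2]. *)
Lemma constructible_bisector (R : realType) (u : R[i]) :
  complex.Re u != 0 -> complex.Im u != 0 ->
  constructible (Line (line_through 0 (u ^+ 2))) ->
  constructible (Line (line_through 0 u)).
Proof.
move=> u1 u2 cl.
have [s [cs sl sm]] := constructible_pair (constructible_real_axis R) cl.
have u0 : 0 != u by rewrite eq_complex negb_and eq_sym u1.
apply/(HJA_constructible cs)/(HJA_O3 sl sm); split.
  (* The two lines differ because the imaginary part of [u ^+ 2] is twice the product of the nonzero
     coordinates of [u]. *)
  move=> lm; have : line_through (0 : R[i]) 1 (u ^+ 2).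
    by rewrite lm; exact: line_through_right.
  rewrite line_throughP 1?eq_sym ?oner_eq0// /cross.
  case: u u1 u2 {u0 cl lm sm} => [x y] /= x0 y0 /eqP.
  apply/negP; rewrite [X in X != 0](_ : _ = 2 * (x * y)); last by ring.
  by rewrite !mulf_neq0 // pnatr_eq0.
exists 0, u; split=> //.
have uu : (complex.Re u ^+ 2 + complex.Im u ^+ 2)%:C = u * u^*.
  case: (u) => x y /=; apply/eqP; rewrite eq_complex /=; apply/andP.
  by split; apply/eqP; ring.
set N := complex.Re u ^+ 2 + _ in uu.
have N0 : N != 0.
  by rewrite lt0r_neq0 // ltr_pwDl ?sqr_ge0 // exprn_even_gt0.
have conjR (t : R) : (t%:C^*)%R = t%:C by exact: conjc_real.
have v0 : (u^*)%R != 0.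
  by apply: contraNneq N0 => v0; move: uu; rewrite v0 mulr0 => -[->].
rewrite /line_through; apply/seteqP; split=> z /=.
  (* A real [t] is reflected to [t * u / u^*], which is [(t / N) * u ^+ 2] since [u * u^* = N]. *)
  move=> [_ [t _ <-] <-]; exists (t / N) => //.
  rewrite /reflect_across !subr0 !add0r mulr1 rmorphM fmorphV /= uu.
  rewrite conjR.
  by field; rewrite v0 eq_sym.
move=> [t _ <-]; exists (t * N)%:C; first by exists (t * N) => //; rewrite subr0 mulr1 add0r.
rewrite /reflect_across !subr0 !add0r conjR rmorphM /= uu.
by field.
Qed.

(** The square of 1 + i is 2i, so the diagonal bisects the angle between the axes. *)
Lemma constructible_diagonal (R : realType) :
  constructible (Line (line_through (0 : R[i]) (1 +i* 1))).
Proof.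
apply: constructible_bisector; rewrite /= ?oner_eq0//.
have -> : (1 +i* 1) ^+ 2 = 0 +i* 2 :> R[i].
  by apply/eqP; rewrite expr2 eq_complex /=; apply/andP; split; apply/eqP; ring.
by apply: constructible_imaginary_axis; rewrite pnatr_eq0.
Qed.

(** Parallels to the diagonal will be drawn as perpendiculars to this line. *)
Lemma constructible_antidiagonal (R : realType) :
  constructible (Line (line_through (0 : R[i]) (1 +i* -1))).
Proof.
apply: (constructible_perp (constructible0 R) (constructible_diagonal R)).
  by rewrite eq_complex /= eq_sym oner_eq0.
by rewrite /dot /=; ring.
Qed.

(** * Coordinates and field operations *)

Lemma constructible_vertical (R : realType) (x y : R) :
  constructible (Point (x +i* y)) ->
  constructible (Line (line_through (x +i* y) (x +i* (y + 1)))).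
Proof.
move=> cz; apply: (constructible_perp cz (constructible_real_axis R)).
  rewrite eq_complex /= eqxx /= -subr_eq0.
  by rewrite (_ : y - _ = -1) ?oppr_eq0 ?oner_eq0//; ring.
by rewrite /dot /=; ring.
Qed.

Lemma constructible_horizontal (R : realType) (x y : R) :
  constructible (Point (x +i* y)) ->
  constructible (Line (line_through (x +i* y) ((x + 1) +i* y))).
Proof.
move=> cz; apply: (constructible_perp cz
  (constructible_imaginary_axis (oner_neq0 R))).
  rewrite eq_complex /= eqxx andbT /= -subr_eq0.
  by rewrite (_ : x - _ = -1) ?oppr_eq0 ?oner_eq0//; ring.
by rewrite /dot /=; ring.
Qed.

Lemma constructible_Re (R : realType) (x y : R) :
  constructible (Point (x +i* y : R[i])) ->
  constructible (Point (x +i* 0 : R[i])).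
Proof.
move=> cz; apply: (constructible_meet (constructible_vertical cz)
  (constructible_real_axis R)); rewrite /cross /=.
- by apply/eqP; lra.
- by ring.
- by ring.
Qed.

Lemma constructible_Im (R : realType) (x y : R) :
  constructible (Point (x +i* y : R[i])) ->
  constructible (Point (0 +i* y : R[i])).
Proof.
move=> cz; apply: (constructible_meet (constructible_horizontal cz)
  (constructible_imaginary_axis (oner_neq0 R))); rewrite /cross /=.
- by apply/eqP; lra.
- by ring.
- by ring.
Qed.

Lemma constructible_diag_of_real (R : realType) (x : R) :
  constructible (Point (x +i* 0 : R[i])) ->
  constructible (Point (x +i* x : R[i])).
Proof.
move=> cz; apply: (constructible_meet (constructible_vertical cz)
  (constructible_diagonal R)); rewrite /cross /=.
- by apply/eqP; lra.
- by ring.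
- by ring.
Qed.

Lemma constructible_diag_of_imaginary (R : realType) (x : R) :
  constructible (Point (0 +i* x : R[i])) ->
  constructible (Point (x +i* x : R[i])).
Proof.
move=> cz; apply: (constructible_meet (constructible_horizontal cz)
  (constructible_diagonal R)); rewrite /cross /=.
- by apply/eqP; lra.
- by ring.
- by ring.
Qed.

(** The diagonal exchanges heights on the imaginary axis with points of the real axis; a vertical
    and a horizontal then locate [x +i* y]. *)
Lemma constructible_coords (R : realType) (x y : R) :
  constructible (Point (x +i* y)) <->
  constructible (Point (x +i* 0)) /\ constructible (Point (y +i* 0)).
Proof.
split=> [cz|[cx /constructible_diag_of_real/constructible_Im cy]].
  split; first exact: constructible_Re cz.
  exact/(@constructible_Re _ _ y)/constructible_diag_of_imaginary/(constructible_Im cz).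
apply: (constructible_meet (constructible_vertical cx)
  (constructible_horizontal cy)); rewrite /cross /=.
- by apply/eqP; lra.
- by ring.
- by ring.
Qed.

(** The parallel to the diagonal through [x +i* y] meets the real axis at [x - y]. *)
Lemma constructible_realB (R : realType) (x y : R) :
  constructible (Point (x +i* 0)) -> constructible (Point (y +i* 0)) ->
  constructible (Point ((x - y) +i* 0)).
Proof.
move=> cx cy; have cz : constructible (Point (x +i* y)).
  exact/constructible_coords.
have cl : constructible (Line (line_through (x +i* y) ((x + 1) +i* (y + 1)))).
  apply: (constructible_perp cz (constructible_antidiagonal R)).
    rewrite eq_complex /= negb_and -subr_eq0.
    by rewrite (_ : x - _ = -1) ?oppr_eq0 ?oner_eq0//; ring.
  by rewrite /dot /=; ring.
apply: (constructible_meet cl (constructible_real_axis R)); rewrite /cross /=.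
- by apply/eqP; lra.
- by ring.
- by ring.
Qed.

(** The line from 0 through [y +i* x] has slope [x / y], which is its height above 1. For [y = 0]
    the quotient is 0 by convention. *)
Lemma constructible_real_div (R : realType) (x y : R) :
  constructible (Point (x +i* 0)) -> constructible (Point (y +i* 0)) ->
  constructible (Point ((x / y) +i* 0)).
Proof.
move=> cx cy; have [->|y0] := eqVneq y 0.
  by rewrite invr0 mulr0; exact: constructible0.
have cz : constructible (Point (y +i* x)) by exact/constructible_coords.
have cl : constructible (Line (line_through 0 (y +i* x))).
  apply: (constructible_line (constructible0 R) cz).
  by rewrite eq_sym eq_complex /= negb_and y0.
suff /constructible_coords[] : constructible (Point (1 +i* (x / y))) by [].
apply: (constructible_meet cl (constructible_vertical (constructible1 R)));
  rewrite /cross /=.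
- by apply: contraNneq y0 => h; apply/eqP; lra.
- by field.
- by ring.
Qed.

Lemma constructible_realM (R : realType) (x y : R) :
  constructible (Point (x +i* 0)) -> constructible (Point (y +i* 0)) ->
  constructible (Point ((x * y) +i* 0)).
Proof.
move=> cx cy; rewrite -[y]invrK; apply: constructible_real_div => //.
by rewrite -[y^-1]mul1r; apply: constructible_real_div => //; exact: constructible1.
Qed.

Lemma constructible_realD (R : realType) (x y : R) :
  constructible (Point (x +i* 0)) -> constructible (Point (y +i* 0)) ->
  constructible (Point ((x + y) +i* 0)).
Proof.
move=> cx cy; rewrite -[y]opprK; apply: constructible_realB => //.
by rewrite -[- y]sub0r; apply: constructible_realB => //; exact: constructible0.
Qed.

Lemma constructibleB (R : realType) (z w : R[i]) :
  constructible (Point z) -> constructible (Point w) ->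
  constructible (Point (z - w)).
Proof.
case: z w => [x1 y1] [x2 y2] /constructible_coords[cx1 cy1].
move=> /constructible_coords[cx2 cy2].
by apply/constructible_coords; split; exact: constructible_realB.
Qed.

Lemma constructible_div (R : realType) (z w : R[i]) :
  constructible (Point z) -> constructible (Point w) ->
  constructible (Point (z / w)).
Proof.
case: z w => [x1 y1] [x2 y2] /constructible_coords[cx1 cy1].
move=> /constructible_coords[cx2 cy2].
have cD := @constructible_realD R; have cB := @constructible_realB R.
have cM := @constructible_realM R; have cV := @constructible_real_div R.
set N := x2 * x2 + y2 * y2.
(* Multiplication by the conjugate of the denominator. For a zero denominator both sides are 0, as
   the inverse of 0 is 0. *)
have -> : (x1 +i* y1) / (x2 +i* y2) =
    ((x1 * x2 + y1 * y2) / N) +i* ((y1 * x2 - x1 * y2) / N).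
  apply/eqP; rewrite eq_complex /= /N -!expr2.
  by apply/andP; split; apply/eqP; ring.
by apply/constructible_coords; split; apply: (cV); rewrite /N; auto 6.
Qed.

Lemma regular_origami_divring_closed (R : realType) :
  divring_closed [in regular_origami R].
Proof.
split=> [|z w|z w]; rewrite !inE -!constructibleP.
- exact: constructible1.
- exact: constructibleB.
- exact: constructible_div.
Qed.

Lemma constructibleM (R : realType) (z w : R[i]) :
  constructible (Point z) -> constructible (Point w) ->
  constructible (Point (z * w)).
Proof.
move=> cz cw; rewrite -[w]invrK; apply: constructible_div => //.
by rewrite -[w^-1]mul1r; apply: constructible_div => //; exact: constructible1.
Qed.

Lemma constructibleX (R : realType) (z : R[i]) n :
  constructible (Point z) -> constructible (Point (z ^+ n)).
Proof.
move=> cz; elim: n => [|n IH]; first by rewrite expr0; exact: constructible1.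
by rewrite exprS; exact: constructibleM.
Qed.

(** * Roots of unity of order a power of 2 *)

Lemma expiD (R : realType) (s t : R) : expi (s + t) = expi s * expi t.
Proof.
rewrite /expi cosD sinD; apply/eqP; rewrite eq_complex /= eqxx.
by rewrite addrC [cos s * _]mulrC [sin s * _]mulrC eqxx.
Qed.

Lemma expi_exp (R : realType) (t : R) n : expi t ^+ n = expi (t *+ n).
Proof.
elim: n => [|n IH]; first by rewrite expr0 mulr0n /expi cos0 sin0.
by rewrite exprS mulrS expiD IH.
Qed.

Lemma zetaM_exp (R : realType) (m n : nat) : (0 < m)%N ->
  zeta R (m * n) ^+ m = zeta R n.
Proof.
move=> m0; rewrite /zeta expi_exp natrM; congr expi.
by rewrite -[LHS]mulr_natr invfM [X in _ * X * _]mulrC mulrA mulfVK// pnatr_eq0 -lt0n.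
Qed.

Lemma cos_sin_dyadic_gt0 (R : realType) k :
  0 < cos (pi / 2 ^+ k.+2 : R) /\ 0 < sin (pi / 2 ^+ k.+2 : R).
Proof.
have t0 : 0 < pi / 2 ^+ k.+2 :> R by rewrite divr_gt0 ?pi_gt0 ?exprn_gt0.
have th : pi / 2 ^+ k.+2 < pi / 2 :> R.
  by rewrite ltr_pM2l ?pi_gt0// ltf_pV2 ?posrE ?exprn_gt0// ltr_eXnr ?ltr1n.
split; first by apply: cos_gt0_pihalf; rewrite th andbT; lra.
by apply: sin_gt0_pihalf; rewrite t0.
Qed.

(** The induction starts from the imaginary axis, at angle pi / 2, and halves the angle at each
    step. *)
Lemma constructible_dyadic_line (R : realType) k :
  constructible (Line (line_through 0 (expi (pi / 2 ^+ k.+1 : R)))).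
Proof.
elim: k => [|k IH].
  rewrite expr1 /expi cos_pihalf sin_pihalf.
  exact: constructible_imaginary_axis (oner_neq0 R).
have [c0 s0] := cos_sin_dyadic_gt0 R k.
apply: constructible_bisector; rewrite ?gt_eqF// expi_exp.
rewrite -mulrnAr -[_ *+ 2]mulr_natr.
by rewrite (exprS _ k.+1) invfM mulrAC mulVf ?pnatr_eq0// mul1r.
Qed.

(* A point [w] on the line of [expi t] gives [w / w^* = expi t ^+ 2], so that
   no square root is needed to normalise. *)
Lemma constructible_expi_sqr (R : realType) (t : R) : cos t != 0 ->
  constructible (Line (line_through 0 (expi t))) ->
  constructible (Point (expi t ^+ 2)).
Proof.
move=> c0 cl; set y := sin t / cos t.
(* The point of the line above 1, at height tan t. *)
have cw : constructible (Point (1 +i* y)).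
  apply: (constructible_meet cl (constructible_vertical (constructible1 R)));
    rewrite /cross /=.
  - by apply: contraNneq c0 => h; apply/eqP; lra.
  - by rewrite /y; field.
  - by ring.
have cw' : constructible (Point (1 +i* - y)).
  have -> : 1 +i* - y = 1 - ((1 +i* y) - 1).
    by apply/eqP; rewrite eq_complex /=; apply/andP; split; apply/eqP; ring.
  have c1 := constructible1 R.
  by apply: constructibleB => //; apply: constructibleB.
have -> : expi t ^+ 2 = (1 +i* y) / (1 +i* - y).
  have w0 : 1 +i* - y != 0 by rewrite eq_complex /= oner_eq0.
  apply: (mulIf w0); rewrite divfK// expr2; apply/eqP.
  have h := cos2Dsin2 t.
  rewrite eq_complex /= /y; apply/andP; split; apply/eqP.
    rewrite -[RHS]h; by field.
  apply: (mulIf c0); transitivity (sin t * (cos t ^+ 2 + sin t ^+ 2)).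
    by field.
  by rewrite h; field.
exact: constructible_div.
Qed.

Lemma zeta_pow2_constructible (R : realType) k :
  constructible (Point (zeta R (2 ^ k))).
Proof.
(* Raising the exponent by 2 makes half the angle of zeta at most pi / 4, so that its cosine is
   nonzero; a fourth power then returns to [2 ^ k]. *)
suff c2 : constructible (Point (zeta R (2 ^ k.+2))).
  rewrite -(@zetaM_exp _ 4); last by [].
  by rewrite -[4%N]/(2 ^ 2)%N -expnD; exact: constructibleX.
have -> : zeta R (2 ^ k.+2) = expi (pi / 2 ^+ k.+2) ^+ 2.
  by rewrite /zeta expi_exp natrX; congr expi; rewrite -[RHS]mulr_natl mulrA.
apply: constructible_expi_sqr (constructible_dyadic_line R k.+1).
by rewrite gt_eqF//; case: (cos_sin_dyadic_gt0 R k).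
Qed.

(** * The descent from n + 1 to n *)

Lemma Im_zeta_gt0 (R : realType) n : (3 <= n)%N -> 0 < complex.Im (zeta R n).
Proof.
move=> n3; have n0 : 0 < n%:R :> R by rewrite ltr0n; apply: leq_trans n3.
apply: sin_gt0_pi; rewrite divr_gt0 ?mulr_gt0 ?pi_gt0//=.
by rewrite ltr_pdivrMr// mulrC ltr_pM2l ?pi_gt0// ltr_nat.
Qed.

Lemma zeta_expn (R : realType) n : (0 < n)%N -> zeta R n ^+ n = 1.
Proof.
move=> n0; rewrite -{1}[n]muln1 zetaM_exp// /zeta divr1.
by rewrite mulr_natl /expi cos2pi sin2pi.
Qed.

(** The cross product equals the squared modulus of [u] times the imaginary part of [w]. With [w] a
    root of unity this shows that consecutive sides of a polygon are not parallel. *)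
Lemma cross_mulr_neq0 (R : realType) (u w : R[i]) :
  u != 0 -> complex.Im w != 0 -> cross u (u * w) != 0.
Proof.
case: u w => [a b] [x y] /= ab y0; rewrite /cross /=.
rewrite [X in X != 0](_ : _ = y * (a ^+ 2 + b ^+ 2)); last by ring.
rewrite mulf_neq0// paddr_eq0 ?sqr_ge0// !sqrf_eq0.
by move: ab; rewrite eq_complex.
Qed.

(* The vertex [B 2] is the intersection of two constructible sides, and
   [zeta n] is the ratio of the sides [B 2 - B 1] and [B 1 - B 0]. *)
Lemma zeta_pred_constructible (R : realType) n : (3 <= n)%N ->
  constructible (Point (zeta R n.+1)) -> constructible (Point (zeta R n)).
Proof.
move=> n3 cz; set z := zeta R n.+1 in cz *; set w := zeta R n.
have w_im : 0 < complex.Im w by exact: Im_zeta_gt0.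
have z_im : 0 < complex.Im z by apply: Im_zeta_gt0; rewrite ltnW.
have w0 : w != 0 by apply: contraTneq w_im => ->; rewrite ltxx.
have w1 : w - 1 != 0.
  by rewrite subr_eq0; apply: contraTneq w_im => ->; rewrite ltxx.
have z1 : z - 1 != 0.
  by rewrite subr_eq0; apply: contraTneq z_im => ->; rewrite ltxx.
(* The values of [r] and [c] solve [c + r = 1] and [c + r * w = z], so the n-gon [B] shares its
   first two vertices with the polygon of powers of [z]. *)
pose r := (z - 1) / (w - 1); pose c := 1 - r; pose B k := c + r * w ^+ k.
have r0 : r != 0 by rewrite mulf_neq0 ?invr_eq0.
have B0 : B 0%N = z ^+ 0 by rewrite /B /c !expr0 mulr1 subrK.
have B1 : B 1%N = z ^+ 1.
  by rewrite /B /c /r !expr1; field.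
have side k : (k < n)%N -> constructible (Line (line_through (B k) (B k.+1))).
  (* [B] is n-periodic since [w ^+ n = 1]. In particular side 2 closes the triangle when [n = 3]. *)
  move=> kn; have -> : B k.+1 = B (k.+1 %% n)%N.
    rewrite /B; congr (c + r * _); rewrite {1}(divn_eq k.+1 n) exprD mulnC exprM.
    by rewrite zeta_expn ?expr1n ?mul1r// (leq_trans _ n3).
  apply: (@constructible_RPA _ n k (fun j => z ^+ j)) => //.
  - by exists 0, 1; split=> [|j _]; rewrite ?oner_eq0// mul1r add0r.
  - by move=> j _; exact: constructibleX.
  - by exists c, r.
have cB2 : constructible (Point (B 2%N)).
  apply: (constructible_meet (side 1%N _) (side 2%N _)) => //.
  - by rewrite (leq_trans _ n3).
  - have -> : B 2%N - B 1%N = r * w * (w - 1) by rewrite /B; ring.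
    have -> : B 3%N - B 2%N = r * w * (w - 1) * w by rewrite /B; ring.
    apply: cross_mulr_neq0; last by rewrite gt_eqF.
    exact: mulf_neq0 (mulf_neq0 r0 w0) w1.
  - by rewrite /cross; ring.
  - by rewrite subrr /cross /=; ring.
have -> : w = (B 2%N - B 1%N) / (B 1%N - B 0%N).
  have -> : B 2%N - B 1%N = w * (r * (w - 1)) by rewrite /B; ring.
  have -> : B 1%N - B 0%N = r * (w - 1) by rewrite /B; ring.
  by rewrite mulfK// mulf_neq0.
apply: constructible_div; apply: constructibleB => //.
- by rewrite B1; exact: constructibleX.
- by rewrite B1; exact: constructibleX.
- by rewrite B0; exact: constructibleX.
Qed.

Lemma zeta_constructible (R : realType) n : (0 < n)%N ->
  constructible (Point (zeta R n)).
Proof.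
(* The descent runs from [2 ^ m = m + d] down to [m], by induction on [d]; every index it visits is
   at least 3. *)
have large m : (3 <= m)%N -> constructible (Point (zeta R m)).
  move=> m3; have [d] : exists d, (2 ^ m = m + d)%N.
    by exists (2 ^ m - m)%N; rewrite subnKC// ltnW// ltn_expl.
  move: (zeta_pow2_constructible R m) => /[swap] ->.
  elim: d => [|d IH]; first by rewrite addn0.
  rewrite addnS => /zeta_pred_constructible cd; apply/IH/cd.
  by rewrite (leq_trans m3) ?leq_addr.
(* Orders 1 and 2 lie below the range of the descent, so [zeta R n] is taken as the cube of
   [zeta R (3 * n)]. *)
move=> n0; rewrite -(@zetaM_exp _ 3)//; apply/constructibleX/large.
by rewrite leq_pmulr.
Qed.

Unset Implicit Arguments.

Theorem lemma4p4 (R : realType) :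
  divring_closed [in regular_origami R] /\
  forall n : nat, (1 <= n)%N -> regular_origami R (zeta R n).
Proof.
split; first exact: regular_origami_divring_closed.
by move=> n n1; apply/constructibleP/zeta_constructible.
Qed.
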